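(* Let $q\in(0,1]$ and let $\lambda(t)\in C^2\bigl((0,\infty),[0,\infty)\bigr)$. The standard orthogonal planar motion with Bernoulli trials ($q$-standard motion), with speed $c>0$, rate function $\lambda(t)$ and probability of change of direction equal to $q$ at each Poisson event, is equal in distribution to a standard orthogonal planar random motion with speed $c$ and rate function $\lambda_q(t)=q\lambda(t)$.
   Context: Directions: $d_k=(\cos(k\pi/2),\sin(k\pi/2))$, $k=0,1,2,3$, with indices taken modulo 4. The standard orthogonal planar random motion with speed $c$ and rate function $\mu(t)$ is the position $(X(t),Y(t))$ of a particle that starts at the origin at time $0$ with initial direction uniformly distributed on $\{d_0,d_1,d_2,d_3\}$, moves with velocity $c\,d_k$ as long as its current direction is $d_k$, and at each event of a non-homogeneous Poisson process with rate function $\mu(t)$ switches from its current direction $d_k$ to $d_{k+1}$ or $d_{k-1}$, each with probability $1/2$ (independently of everything else). The $q$-standard motion with rate function $\lambda(t)$ is defined in the same way, with Poisson rate function $\lambda(t)$, except that at each Poisson event the particle keeps its current direction $d_k$ with probability $1-q$ and switches to $d_{k+1}$ or to $d_{k-1}$ with probability $q/2$ each. *)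

(* Defs.v *)
From HB Require Import structures.
From mathcomp Require Import all_boot all_order all_algebra.
From mathcomp Require Import finmap.
From mathcomp Require Import all_classical all_reals all_analysis.

Set Implicit Arguments.
Unset Strict Implicit.
Unset Printing Implicit Defensive.

Import Order.TTheory GRing.Theory Num.Theory.
Import numFieldNormedType.Exports.

Local Open Scope classical_set_scope.
Local Open Scope ring_scope.

HB.instance Definition _ (n : nat) := isPointed.Build 'I_n.+1 ord0.
HB.instance Definition _ (n : nat) :=
  @isMeasurable.Build default_measure_display 'I_n.+1
    discrete_measurable discrete_measurable0
    discrete_measurableC discrete_measurableU.

Section C2.
Context {R : realType}.

Definition C2_pos (f : R -> R) : Prop :=
  forall t : R, 0 < t ->
    [/\ derivable f t 1, derivable (derive1 f) t 1 &
        {for t, continuous (derive1n 2 f)}].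

End C2.

Section processes.
Context {R : realType}.

(* The sigma-algebra on A generated by f t for t >= 0; negative times play no
   role for any process below. *)
Definition process_sigma {A : Type} {d} {S : measurableType d}
    (f : R -> A -> S) : set (set A) :=
  <<s \bigcup_(t in [set t : R | 0 <= t])
        preimage_set_system setT (f t) measurable >>.

(* On the space of planar paths: the product (cylinder) sigma-algebra. *)
Definition path_sigma : set (set (R -> R * R)) :=
  process_sigma (fun t (w : R -> R * R) => w t).

(* Equality of the laws of (X, Y) and (X', Y') on path space, the two processes
   possibly living on different probability spaces. *)
Definition equal_in_distribution
    {d} {T : measurableType d} (P : probability T R) (X Y : R -> T -> R)
    {d'} {T' : measurableType d'} (P' : probability T' R)
    (X' Y' : R -> T' -> R) : Prop :=
  forall A : set (R -> R * R), path_sigma A ->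
    P [set w | A (fun t => (X t w, Y t w))] =
    P' [set w | A (fun t => (X' t w, Y' t w))].

Context {d} {T : measurableType d} (P : probability T R).

Definition mutually_independent {I : choiceType} (F : I -> set (set T)) : Prop :=
  forall (J : {fset I}) (E : I -> set T),
    (forall i, i \in J -> F i (E i)) ->
    P (\bigcap_(i in [set` J]) E i) = (\prod_(i <- J) P (E i))%E.

(* The Poisson weights are written out because poisson_pmf is not the Dirac
   mass at 0 when its parameter is 0, which occurs where mu vanishes. *)
Definition is_poisson_process (mu : R -> R) (N : R -> T -> nat) : Prop :=
  [/\ (forall t : R, 0 < t ->
         lebesgue_measure.-integrable `]0, t] (EFin \o mu)),
      (forall t : R, 0 <= t -> measurable_fun setT (N t)),
      (forall w, [/\ N 0 w = 0%N,
         (forall s t : R, 0 <= s -> s <= t -> (N s w <= N t w)%N) &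
         (forall t : R, 0 <= t -> \forall s \near t^'+, N s w = N t w)]),
      (forall t : nat -> R, 0 <= t 0%N -> (forall i, t i <= t i.+1) ->
         mutually_independent (fun i : nat =>
           preimage_set_system setT
             (fun w => (N (t i.+1) w - N (t i) w)%N) measurable)) &
      (forall (s t : R) (k : nat), 0 <= s -> s <= t ->
         let m := \int[lebesgue_measure]_(u in `]s, t]) mu u in
         P [set w | (N t w - N s w)%N = k] =
           (expR (- m) * m ^+ k / k`!%:R)%:E)].

(* The direction d_k is indexed by k in 'Z_4. D0 is the index of the initial
   direction, N counts the Poisson events, and xi n is the change of index at
   the (n + 1)-st event. *)
Definition direction (D0 : T -> 'Z_4) (N : R -> T -> nat)
    (xi : nat -> T -> 'Z_4) (t : R) (w : T) : 'Z_4 :=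
  D0 w + \sum_(n < N t w) xi n w.

(* A motion (X, Y) started at the origin whose changes of direction index at
   the Poisson events have probability mass function turn. *)
Definition is_orthogonal_motion (turn : 'Z_4 -> R) (c : R) (mu : R -> R)
    (X Y : R -> T -> R) : Prop :=
  exists (D0 : {RV P >-> 'Z_4}) (N : R -> T -> nat)
         (xi : nat -> {RV P >-> 'Z_4}),
    [/\ (forall k, distribution P D0 [set k] = (4^-1)%:E),
        is_poisson_process mu N,
        (forall n k, distribution P (xi n) [set k] = (turn k)%:E),
        mutually_independent (fun i : nat =>
          match i with
          | 0 => preimage_set_system setT D0 measurable
          | 1 => process_sigma N
          | n.+2 => preimage_set_system setT (xi n) measurable
          end) &
        let angle s w := (direction D0 N xi s w : nat)%:R * pi / 2 in
        forall (t : R) (w : T), 0 <= t ->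
          X t w = \int[lebesgue_measure]_(s in `[0, t]) (c * cos (angle s w)) /\
          Y t w = \int[lebesgue_measure]_(s in `[0, t]) (c * sin (angle s w))].

Definition standard_turn (k : 'Z_4) : R :=
  if (k == 1) || (k == -1) then 2^-1 else 0.

Definition bernoulli_turn (q : R) (k : 'Z_4) : R :=
  if k == 0 then 1 - q else if (k == 1) || (k == -1) then q / 2 else 0.

Definition is_standard_motion (c : R) (mu : R -> R) (X Y : R -> T -> R) :=
  is_orthogonal_motion standard_turn c mu X Y.

Definition is_q_standard_motion (q c : R) (lambda : R -> R)
    (X Y : R -> T -> R) :=
  is_orthogonal_motion (bernoulli_turn q) c lambda X Y.

End processes.

(* Main.v *)
Require Import Defs.
From HB Require Import structures.
From mathcomp Require Import all_boot all_order all_algebra.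
From mathcomp Require Import finmap.
From mathcomp Require Import all_classical all_reals all_analysis.
From mathcomp Require Import measurable_realfun.
From mathcomp Require Import ring.

Import Order.TTheory GRing.Theory Num.Theory.
Import numFieldNormedType.Exports.
Local Open Scope classical_set_scope.
Local Open Scope ring_scope.

(** Thinning a Poisson process of intensity lambda by independent Bernoulli(q)
trials gives a Poisson process of intensity q * lambda, so the two motions turn
at the same rate.  The proof makes this quantitative on the direction process
alone and treats both motions at once: a standard motion is the case q = 1 of
the motion with Bernoulli trials (standard_turnE).

The index of the direction performs a random walk on Z/4 run by a Poisson clock.
The law of one step has Fourier coefficients 1, 1 - 2q and 1 - q (the last one
twice), so the law of n steps has the n-th powers of these as coefficients
(fourier_pmf_conv, tail_independent_walk).  Averaging over a Poisson number of
steps of mean m turns a coefficient x into exp (m (x - 1)) (poisson_mix): the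
increment of the direction over a time interval has coefficients 1, exp (-2qm)
and exp (-qm), where m is the integral of the rate.  Together with the
independence of disjoint time intervals this gives an explicit formula for the
finite-dimensional laws of the direction (direction_prob), in which q and the
rate occur only through q times the rate.

Finite-dimensional laws determine the law on the space of direction paths
(direction_law_unique).  Since the directions are right-continuous, the position
is a fixed measurable functional of the direction path: the direction at time s
is the limit of its values on grids that approach s from the right, and this
limit is jointly measurable in time and path, so that its integral over time is
measurable by Tonelli (measurable_displacement, displacement_right_cont).  Hence
equal laws of the directions give equal laws of the positions
(equal_in_distribution_displacement). *)

(** * Position as a measurable functional of the direction path *)

Section displacement.
Context {R : realType}.

(** The type of all direction paths, measurable for the sigma-algebra generated
by the evaluations at nonnegative times. *)
Definition direction_path : Type :=
  g_sigma_algebraType (\bigcup_(t in [set t : R | 0 <= t])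
    preimage_set_system setT (fun w : R -> 'Z_4 => w t) measurable).

HB.instance Definition _ := Measurable.on direction_path.

Lemma measurable_eval (t : R) : 0 <= t ->
  measurable_fun setT (fun w : direction_path => w t).
Proof.
move=> t0 _ B mB; apply: sub_sigma_algebra; exists t => //=.
by exists B.
Qed.

Lemma measurable_natP {d} {T : measurableType d} (f : T -> nat) :
  (forall n, measurable (f @^-1` [set n])) -> measurable_fun setT f.
Proof.
move=> mf _ B _; rewrite setTI.
rewrite (_ : f @^-1` B = \bigcup_(n in B) (f @^-1` [set n])).
  by apply: bigcup_measurable.
by apply/seteqP; split => [x Bx|x [n Bn /= fxn]]; [by exists (f x)|by rewrite /= fxn].
Qed.

Lemma measurable_nat_select {d d'} {S : measurableType d} {T : measurableType d'}
    {d''} {U : measurableType d''} (a : S -> nat) (g : nat -> T -> U) :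
  measurable_fun setT a -> (forall n, measurable_fun setT (g n)) ->
  measurable_fun setT (fun x : T * S => g (a x.2) x.1).
Proof.
move=> ma mg _ B mB; rewrite setTI.
rewrite (_ : _ @^-1` B = \bigcup_n ((g n @^-1` B) `*` (a @^-1` [set n]))).
  apply: bigcupT_measurable => n; apply: measurableX.
    by rewrite -[X in measurable X]setTI; exact: mg.
  by rewrite -[X in measurable X]setTI; exact: ma.
apply/seteqP; split => [[x s] /= Bx|[x s] [n _ [/= Bx asn]]]; last by rewrite /= asn.
by exists (a s).
Qed.

(** A point of the grid of mesh 1 / (n + 1), strictly to the right of s whenever
s is nonnegative; the absolute value keeps the index measurable on the whole
line. *)
Definition sample (n : nat) (s : R) : R :=
  (Num.truncn (`|s| * n.+1%:R)).+1%:R / n.+1%:R.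

Lemma measurable_sample_index (n : nat) :
  measurable_fun setT (fun s : R => Num.truncn (`|s| * n.+1%:R)).
Proof.
apply: measurable_natP => j.
rewrite (_ : _ @^-1` _ =
  (fun s : R => `|s| * n.+1%:R) @^-1` `[j%:R, j.+1%:R[%classic); last first.
  apply/seteqP; split => s /=.
    by move=> <-; rewrite in_itv /= truncn_itv// mulr_ge0.
  rewrite in_itv /= => sj; apply: truncn_def.
  by move: sj; rewrite -natr1 natr1.
rewrite -[X in measurable X]setTI.
have mf : measurable_fun setT (fun s : R => `|s| * n.+1%:R).
  by apply: measurable_funM => //; exact: normr_measurable.
by apply: mf.
Qed.

Lemma sample_gt (n : nat) (s : R) : 0 <= s -> s < sample n s.
Proof.
move=> s0; rewrite /sample ltr_pdivlMr// ger0_norm//.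
by have /andP[] := truncn_itv (mulr_ge0 s0 (ler0n R n.+1)).
Qed.

Lemma sample_le (n : nat) (s : R) : 0 <= s -> sample n s <= s + n.+1%:R^-1.
Proof.
move=> s0; rewrite /sample ler_pdivrMr// mulrDl mulVf// ger0_norm// -natr1 lerD2r.
by have /andP[] := truncn_itv (mulr_ge0 s0 (ler0n R n.+1)).
Qed.

Lemma sample_cvg (s : R) : 0 <= s -> sample n s @[n --> \oo] --> s^'+.
Proof.
move=> s0 A; rewrite /at_right => -[e /= e0 sA].
have : \forall n \near \oo, (n.+1%:R^-1 : R) < e.
  exact: (near_infty_natSinv_lt (PosNum e0)).
apply: filterS => n ne /=; apply: sA => /=; last exact: sample_gt.
rewrite ltr0_norm ?subr_lt0 ?sample_gt// opprB ltrBlDl.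
by apply: le_lt_trans (sample_le n s s0) _; rewrite ltrD2l.
Qed.

(** A limit superior, so that it is measurable on all paths; at s
nonnegative, if w is right-continuous there, it is the value phi (w s). *)
Definition right_limit (phi : 'Z_4 -> R) (w : R -> 'Z_4) (s : R) : \bar R :=
  limn_esup (fun n => (phi (w (sample n s)))%:E).

Definition displacement (phi : 'Z_4 -> R) (t : R) (w : direction_path) : R :=
  fine (\int[lebesgue_measure]_(s in `[0, t]) right_limit phi w s).

(** At each mesh the sampled direction takes, jointly in time and path, one of
countably many evaluations, chosen by a measurable index; the limit superior is
thus jointly measurable and Tonelli applies to its positive and negative parts. *)
Lemma measurable_displacement (phi : 'Z_4 -> R) (t : R) :
  measurable_fun setT (displacement phi t).
Proof.
pose g := (fun x : direction_path * measurableTypeR R => right_limit phi x.1 x.2).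
have mg : measurable_fun setT g.
  apply: measurable_fun_limn_esup => n; apply: measurableT_comp => //.
  apply: (measurable_nat_select (fun s : measurableTypeR R => Num.truncn (`|s| * n.+1%:R))
    (fun j (w : direction_path) => phi (w (j.+1%:R / n.+1%:R)))).
    exact: measurable_sample_index.
  move=> j; apply: (measurableT_comp (f := phi)) => //.
  by apply: measurable_eval.
pose h := (fun x : direction_path * measurableTypeR R =>
  if x.2 \in `[0, t] then g x else 0%E).
have mh : measurable_fun setT h.
  apply: measurable_fun_ifT => //.
  apply: (measurable_fun_bool true); rewrite setTI.
  rewrite (_ : _ @^-1` _ = snd @^-1` `[0, t]%classic) //.
  by rewrite -[X in measurable X]setTI; exact: measurable_snd.
rewrite /displacement; apply: measurableT_comp => //.
rewrite (_ : (fun _ => _) = (fun w => \int[lebesgue_measure]_s (h^\+ (w, s))) \-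
   (fun w => \int[lebesgue_measure]_s (h^\- (w, s))))%E.
  apply: emeasurable_funB.
    apply: (measurable_fun_fubini_tonelli_F (m2 := lebesgue_measure) (h^\+)%E) => //.
    exact: measurable_funepos.
  apply: (measurable_fun_fubini_tonelli_F (m2 := lebesgue_measure) (h^\-)%E) => //.
  exact: measurable_funeneg.
apply/funext => w /=; rewrite integral_mkcond integralE.
congr (_ - _)%E; apply: eq_integral => s _;
  by rewrite /= !(funeposE, funenegE) /patch mem_setE.
Qed.

(** With finitely many directions, right-continuity means that the sampled
direction is eventually constant. *)
Lemma displacement_right_cont (phi : 'Z_4 -> R) (t : R) (w : R -> 'Z_4) :
  (forall s, 0 <= s -> \forall u \near s^'+, w u = w s) ->
  displacement phi t w = \int[lebesgue_measure]_(s in `[0, t]) phi (w s).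
Proof.
move=> rc; rewrite /displacement /Rintegral; congr fine.
apply: eq_integral => s /[!inE] /=; rewrite in_itv /= => /andP[s0 _].
rewrite /right_limit.
have cv : (phi (w (sample n s)))%:E @[n --> \oo] --> (phi (w s))%:E.
  apply: cvg_near_cst => /=.
  have : \forall n \near \oo, w (sample n s) = w s := sample_cvg s s0 _ (rc s s0).
  by apply: filterS => n ->.
by rewrite (cvg_limn_einf_sup cv).2.
Qed.

End displacement.
(** * Random walk on Z/4 and its Poisson average *)

Section fourier.
Context {R : realType}.
Implicit Types (q x y : R) (k : 'Z_4).

(** The symmetric function on Z/4 with total mass 1 and Fourier coefficient x at
the character of order 2, and y at the two characters of order 4. *)
Definition fourier_pmf x y k : R :=
  match nat_of_ord k with
  | 0 => (1 + x + 2 * y) / 4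
  | 2 => (1 + x - 2 * y) / 4
  | _ => (1 - x) / 4
  end.

(** All Fourier coefficients equal to 1: the Dirac mass at 0. *)
Lemma fourier_pmf11 k : fourier_pmf 1 1 k = (k == 0)%:R.
Proof. by case: k => -[|[|[|[|//]]]] ik; rewrite /fourier_pmf /=; field. Qed.

(** Convolution multiplies Fourier coefficients, and those of the Bernoulli turn
are 1 - 2q at the character of order 2 and 1 - q at those of order 4. *)
Lemma fourier_pmf_conv q x y k :
  \sum_(l : 'Z_4) fourier_pmf x y (k - l) * bernoulli_turn q l =
  fourier_pmf (x * (1 - 2 * q)) (y * (1 - q)) k.
Proof.
rewrite !big_ord_recl big_ord0.
by case: k => -[|[|[|[|//]]]] ik; rewrite /fourier_pmf /bernoulli_turn /=; field.
Qed.

(** fourier_pmf is affine in its two coefficients, so the series is a combination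
of the three exponential series at m, m * x and m * y. *)
Lemma poisson_mix a m x y k :
  (\sum_(n <oo) (a * (expR (- m) * m ^+ n / n`!%:R *
                      fourier_pmf (x ^+ n) (y ^+ n) k))%:E)%E
  = (a * fourier_pmf (expR (m * (x - 1))) (expR (m * (y - 1))) k)%:E.
Proof.
have cvE z : (\sum_(0 <= n < N) exp_coeff (m * z) n) @[N --> \oo] --> expR (m * z).
  exact: is_cvg_series_exp_coeff.
have expE z : expR (m * (z - 1)) = expR (- m) * expR (m * z).
  by rewrite -expRD mulrBr mulr1 addrC.
pose f X Y Z := a * (fourier_pmf 0 0 k * (expR (- m) * X) +
  (fourier_pmf 1 0 k - fourier_pmf 0 0 k) * (expR (- m) * Y) +
  (fourier_pmf 0 1 k - fourier_pmf 0 0 k) * (expR (- m) * Z)).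
apply: cvg_lim => //.
rewrite (_ : (fun _ => _) = (fun N => (f (\sum_(0 <= n < N) exp_coeff (m * 1) n)
  (\sum_(0 <= n < N) exp_coeff (m * x) n)
  (\sum_(0 <= n < N) exp_coeff (m * y) n))%:E)); last first.
  apply/funext => N; rewrite sumEFin; congr EFin.
  rewrite /f !mulr_sumr -!big_split /= mulr_sumr; apply: eq_bigr => n _.
  rewrite /exp_coeff /= !exprMn expr1n mulr1.
  by case: k @f => -[|[|[|[|//]]]] ik; rewrite /fourier_pmf /=; field.
apply: cvg_EFin; first exact: nearW.
rewrite (_ : a * _ = f (expR (m * 1)) (expR (m * x)) (expR (m * y))); last first.
  rewrite /f -!expE subrr mulr0 expR0.
  by case: k @f => -[|[|[|[|//]]]] ik; rewrite /fourier_pmf /=; field.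
have cvZ (b l : R) (u : nat -> R) : u @ \oo --> l -> b * u n @[n --> \oo] --> b * l.
  by move=> ul; apply: cvgM => //; exact: cvg_cst.
by apply: (cvZ); apply: cvgD; [apply: cvgD|]; do 2 apply: (cvZ); exact: cvE.
Qed.

End fourier.

(** * Independence of the past and the future turns *)

Lemma mutually_independent_nat {R : realType} {d} {T : measurableType d}
    (P : probability T R) (F : nat -> set (set T)) (E : nat -> set T) (M : nat) :
  mutually_independent P F -> (forall i, (i < M)%N -> F i (E i)) ->
  P [set w | forall i, (i < M)%N -> E i w] = (\prod_(i < M) P (E i))%E.
Proof.
move=> ind FE; pose J := [fset i in iota 0 M]%fset.
have JE i : (i \in J) = (i < M)%N by rewrite !inE /= mem_iota.
have -> : [set w | forall i, (i < M)%N -> E i w] = \bigcap_(i in [set` J]) E i.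
  by apply/seteqP; split => w /= Ew i; [rewrite /= JE|rewrite -JE]; exact: Ew.
rewrite ind; last by move=> i; rewrite JE; exact: FE.
rewrite -(big_mkord xpredT (fun i => P (E i))); apply: perm_big.
apply: uniq_perm; [exact: fset_uniq|exact: iota_uniq|].
by move=> i; rewrite JE mem_index_iota.
Qed.

Lemma measure_exists {R : realType} {d} {T : measurableType d}
    (P : {measure set T -> \bar R}) (I : finType) (E : I -> set T) :
  (forall l, measurable (E l)) -> (forall l m w, E l w -> E m w -> l = m) ->
  P [set w | exists l, E l w] = (\sum_l P (E l))%E.
Proof.
move=> mE disjE.
rewrite (_ : [set w | _] = \bigcup_l E l).
  rewrite measure_fin_bigcup//; last 2 first.
  - exact: finite_finset.
  - by move=> l m _ _ [w [/disjE h/h]].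
  rewrite (@fsbigTE _ _ _ _ [fset x in index_enum I]%fset); last first.
    by move=> l; rewrite inE /= mem_index_enum.
  apply: perm_big; apply: uniq_perm; rewrite ?fset_uniq ?index_enum_uniq//.
  by move=> l; rewrite !inE /= !mem_index_enum.
by apply/seteqP; split => w /= [l]; [exists l|move=> _; exists l].
Qed.

Section tail_independence.
Context {R : realType} {d} {T : measurableType d} (P : probability T R).
Variables (xi : nat -> {RV P >-> 'Z_4}) (turn : 'Z_4 -> R).

(** E has probability r and is independent of the turns with index at least j,
which are themselves independent with law turn.  Carrying r along lets each step
of a computation deliver a probability and the independence needed by the next
step. *)
Definition tail_independent (E : set T) (j : nat) (r : R) : Prop :=
  measurable E /\
  forall M (x : nat -> 'Z_4),
    P [set w | E w /\ forall i, (i < M)%N -> xi (j + i)%N w = x i] =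
    (r * \prod_(i < M) turn (x i))%:E.

Lemma tail_independent_prob E j r : tail_independent E j r -> P E = r%:E.
Proof.
move=> [_ /(_ 0%N (fun=> 0))]; rewrite big_ord0 mulr1 => <-; congr (P _).
by apply/seteqP; split => w //= [].
Qed.

Lemma measurable_RV_eq (f : {RV P >-> 'Z_4}) (k : 'Z_4) :
  measurable [set w | f w = k].
Proof.
have := @measurable_funPTI _ _ _ _ f [set k].
exact.
Qed.

Lemma tail_independent_next E j r y : tail_independent E j r ->
  tail_independent [set w | E w /\ xi j w = y] j.+1 (r * turn y).
Proof.
move=> [mE indE]; split; first exact: measurableI (measurable_RV_eq _ _).
move=> M x; rewrite -mulrA.
have := indE M.+1 (fun i => if i is i'.+1 then x i' else y).
rewrite big_ord_recl /= => <-; congr (P _); apply/seteqP; split => w /=.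
  move=> [[Ew xj] xM]; split => // -[|i] iM; first by rewrite addn0.
  by rewrite addnS -addSn xM.
move=> [Ew xM]; split; first by split=> //; have := xM 0%N isT; rewrite addn0.
by move=> i iM; rewrite addSn -addnS (xM i.+1).
Qed.

Lemma tail_independent_exists (E : 'Z_4 -> set T) j (r : 'Z_4 -> R) :
  (forall l m w, E l w -> E m w -> l = m) ->
  (forall l, tail_independent (E l) j (r l)) ->
  tail_independent [set w | exists l, E l w] j (\sum_l r l).
Proof.
move=> disjE indE.
have mtail M (x : nat -> 'Z_4) :
    measurable [set w | forall i, (i < M)%N -> xi (j + i)%N w = x i].
  rewrite (_ : [set w | _] =
      \bigcap_(i in `I_M) [set w | xi (j + i)%N w = x i]) //.
  by apply: bigcap_measurableType => i _; exact: measurable_RV_eq.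
split.
  rewrite (_ : [set w | _] = \bigcup_l E l).
    by apply: fin_bigcup_measurable => // l _; have [] := indE l.
  by apply/seteqP; split => w /= [l]; [exists l|move=> _; exists l].
move=> M x.
rewrite (_ : [set w | _] = [set w | exists l, E l w /\
    forall i, (i < M)%N -> xi (j + i)%N w = x i]); last first.
  apply/seteqP; split => w /= => [[[l Elw] xM]|[l [Elw xM]]]; first by exists l.
  by split => //; exists l.
rewrite measure_exists.
- rewrite mulr_suml -sumEFin; apply: eq_bigr => l _.
  exact: (indE l).2.
- by move=> l; apply: measurableI; [have [] := indE l|exact: mtail].
- by move=> l m w [El _] [Em _]; exact: disjE El Em.
Qed.

(** Induction on n, splitting according to the value of the last turn: this is the
convolution of fourier_pmf_conv. *)
Lemma tail_independent_walk q E j r n k : turn = bernoulli_turn q ->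
  tail_independent E j r ->
  tail_independent [set w | E w /\ \sum_(i < n) xi (j + i)%N w = k] (j + n)
    (r * fourier_pmf ((1 - 2 * q) ^+ n) ((1 - q) ^+ n) k).
Proof.
move=> turnE indE; elim: n k => [|n IHn] k.
  rewrite addn0 !expr0 fourier_pmf11; have [->|k0] := eqVneq k 0.
    rewrite mulr1 (_ : [set w | _] = E) //.
    by apply/seteqP; split => w /=; rewrite big_ord0 => // -[].
  rewrite mulr0 (_ : [set w | _] = set0).
    split; first exact: measurable0.
    move=> M x; rewrite mul0r (_ : [set w | _] = set0) ?measure0//.
    by apply/seteqP; split => w // [].
  by apply/seteqP; split => w //=; rewrite big_ord0 => -[_ /esym/eqP]; rewrite (negbTE k0).
rewrite (_ : [set w | _] = [set w | exists l, (E w /\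
    \sum_(i < n) xi (j + i)%N w = k - l) /\ xi (j + n)%N w = l]).
  rewrite !exprSr -fourier_pmf_conv mulr_sumr addnS.
  apply: tail_independent_exists => [l m w [_ <-] [_ <-]//|l].
  rewrite mulrA -turnE; apply: tail_independent_next; exact: IHn.
apply/seteqP; split => w /=; rewrite big_ord_recr /=.
  by move=> [Ew <-]; exists (xi (j + n)%N w); rewrite addrK.
by move=> [l [[Ew ->] ->]]; rewrite subrK.
Qed.

(** Consecutive blocks of turns, of lengths n 0, n 1 and so on, use disjoint sets
of indices, so each block leaves the later ones independent of the past. *)
Lemma tail_independent_walks q E r (n : nat -> nat) (k : nat -> 'Z_4) m :
  turn = bernoulli_turn q -> tail_independent E 0 r ->
  tail_independent [set w | E w /\ forall i, (i < m)%N ->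
      \sum_(l < n i) xi (\sum_(h < i) n h + l)%N w = k i]
    (\sum_(h < m) n h)
    (r * \prod_(i < m) fourier_pmf ((1 - 2 * q) ^+ n i) ((1 - q) ^+ n i) (k i)).
Proof.
move=> turnE indE; elim: m => [|m IHm].
  rewrite !big_ord0 mulr1 (_ : [set w | _] = E) //.
  by apply/seteqP; split => w //= [].
rewrite !big_ord_recr /= mulrA.
have := tail_independent_walk q _ _ _ (n m) (k m) turnE IHm.
set F := [set w | _]; set G := [set w | _]; suff -> : F = G by [].
apply/seteqP; split => w /=.
  move=> [[Ew km] kmm]; split => // i; rewrite ltnS leq_eqVlt => /predU1P[->//|].
  exact: km.
by move=> [Ew km]; split; [split => // i im; apply: km; rewrite ltnS ltnW|exact: km].
Qed.

End tail_independence.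
(** * Finite-dimensional laws of the direction *)

Lemma measurable_forall_lt {d} {T : measurableType d} (E : nat -> set T) m :
  (forall i, (i < m)%N -> measurable (E i)) ->
  measurable [set w | forall i, (i < m)%N -> E i w].
Proof. by move=> mE; exact: bigcap_measurableType. Qed.

Lemma measurable_Z4_op {d} {T : measurableType d} (h : 'Z_4 -> 'Z_4 -> 'Z_4)
    (f g : T -> 'Z_4) : measurable_fun setT f -> measurable_fun setT g ->
  measurable_fun setT (fun w => h (f w) (g w)).
Proof.
move=> mf mg _ B _; rewrite setTI.
rewrite (_ : _ @^-1` B =
    \bigcup_l (f @^-1` [set x | B (h x l)] `&` g @^-1` [set l])).
  apply: fin_bigcup_measurable => [|l _]; first exact: finite_finset.
  by apply: measurableI; rewrite -[X in measurable X]setTI; [exact: mf|exact: mg].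
by apply/seteqP; split => w /= => [Bw|[l _ [/= ? ->]]//]; exists (g w).
Qed.

Section motion.
Context {R : realType} {d} {T : measurableType d} (P : probability T R).
Variables (q : R) (mu : R -> R).
Variables (D0 : {RV P >-> 'Z_4}) (N : R -> T -> nat) (xi : nat -> {RV P >-> 'Z_4}).
Hypothesis D0_unif : forall k, distribution P D0 [set k] = (4^-1)%:E.
Hypothesis N_poisson : is_poisson_process P mu N.
Hypothesis xi_turn : forall n k, distribution P (xi n) [set k] = (bernoulli_turn q k)%:E.
Hypothesis indep : mutually_independent P (fun i : nat =>
  match i with
  | 0 => preimage_set_system setT D0 measurable
  | 1 => process_sigma N
  | n.+2 => preimage_set_system setT (xi n) measurable
  end).

Let dir := direction D0 N xi.

Let measurable_N t : 0 <= t -> measurable_fun setT (N t).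
Proof. by case: N_poisson => _ mN _ _ _; exact: mN. Qed.

Let N_mono s t w : 0 <= s -> s <= t -> (N s w <= N t w)%N.
Proof. by case: N_poisson => _ _ /(_ w)[_ +  _] _ _; apply. Qed.

Lemma measurable_direction t : 0 <= t -> measurable_fun setT (dir t).
Proof.
move=> t0.
have mS n : measurable_fun setT (fun w => D0 w + \sum_(i < n) xi i w).
  elim: n => [|n IHn].
    under eq_fun do rewrite big_ord0 addr0.
    exact: measurable_funPT.
  under eq_fun do rewrite big_ord_recr /= addrA.
  by apply: (measurable_Z4_op +%R) => //; exact: measurable_funPT.
have msel := measurable_nat_select (fun n : nat => n)
  (fun n w => D0 w + \sum_(i < n) xi i w) (@measurable_id _ _ _) mS.
have mpair : measurable_fun setT (fun w => (w, N t w)).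
  by apply: measurable_fun_pair => //; exact: measurable_N.
exact: (measurableT_comp msel mpair).
Qed.

Lemma direction_right_cont w s : 0 <= s ->
  \forall u \near s^'+, dir u w = dir s w.
Proof.
move=> s0; case: N_poisson => _ _ /(_ w)[_ _ /(_ s s0)] Nrc _ _.
by apply: filterS Nrc => u Nu; rewrite /dir /direction Nu.
Qed.

Section increments.
Variable t : nat -> R.
Hypotheses (t0 : t 0%N = 0) (t_nd : forall i, t i <= t i.+1).

Let t_ge0 i : 0 <= t i.
Proof. by elim: i => [|i /le_trans]; rewrite ?t0//; apply. Qed.

Let J i w := (N (t i.+1) w - N (t i) w)%N.
Let mass i := \int[lebesgue_measure]_(u in `]t i, t i.+1]) mu u.
Let pois i n := expR (- mass i) * mass i ^+ n / n`!%:R.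

Lemma counts_prob (n : nat -> nat) m :
  P [set w | forall i, (i < m)%N -> J i w = n i] =
  (\prod_(i < m) pois i (n i))%:E.
Proof.
case: N_poisson => _ _ _ indN PN.
have := mutually_independent_nat P _ (fun i => J i @^-1` [set n i]) m (indN t _ t_nd).
move=> ->; last 2 first.
- by rewrite t0.
- by move=> i _; exists [set n i] => //; rewrite setTI.
rewrite -prodEFin; apply: eq_bigr => i _; exact: PN.
Qed.

(** Prescribing the increments of the counting process is the same as prescribing
its values, since it starts from 0 and is monotone; the latter form is visibly in
the sigma-algebra of the process. *)
Lemma countsE (n : nat -> nat) m w : (forall i, (i < m)%N -> J i w = n i) <->
  (forall i, (i < m)%N -> N (t i.+1) w = (\sum_(h < i.+1) n h)%N).
Proof.
have N0 : N (t 0) w = 0%N by rewrite t0; case: N_poisson => _ _ /(_ w)[].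
have NS i : N (t i.+1) w = (N (t i) w + J i w)%N by rewrite subnKC// N_mono.
split=> [Jn|Nn] i im.
  elim: i im => [|i IHi] im; first by rewrite NS N0 Jn// big_ord_recl big_ord0 addn0.
  by rewrite NS Jn// IHi ?(ltnW im)// [RHS]big_ord_recr.
apply/eqP; rewrite -(eqn_add2l (N (t i) w)) -NS Nn// big_ord_recr /= eqn_add2r.
by case: i im => [|i] im; rewrite ?N0 ?big_ord0// Nn// ltnW.
Qed.

Lemma counts_sigma (n : nat -> nat) m :
  process_sigma N [set w | forall i, (i < m)%N -> J i w = n i].
Proof.
rewrite (_ : [set w | _] =
  [set w | forall i, (i < m)%N -> N (t i.+1) w = (\sum_(h < i.+1) n h)%N]); last first.
  by apply/seteqP; split => w /countsE.
apply: (@measurable_forall_lt _ (g_sigma_algebraType (\bigcup_(t in [set t : R | 0 <= t])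
        preimage_set_system setT (N t) measurable))) => i im.
apply: sub_sigma_algebra; exists (t i.+1); first exact: t_ge0.
by exists [set (\sum_(h < i.+1) n h)%N] => //; rewrite setTI.
Qed.

(** The initial direction and the event counts, jointly, are independent of all
the turns; from this event the walk of the direction starts. *)
Lemma tail_independent_start k0 (n : nat -> nat) m :
  tail_independent P xi (bernoulli_turn q)
    [set w | D0 w = k0 /\ forall i, (i < m)%N -> J i w = n i] 0
    (4^-1 * \prod_(i < m) pois i (n i)).
Proof.
pose B := [set w | forall i, (i < m)%N -> J i w = n i].
have mB : measurable B.
  apply: (smallest_sub (@sigma_algebra_measurable _ T) _ (counts_sigma n m)).
  move=> _ [s s0] [A _ <-]; exact: measurable_N.
split; first exact: measurableI (measurable_RV_eq _ _ _) mB.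
move=> M x.
pose E i := match i with 0 => D0 @^-1` [set k0] | 1 => B | i.+2 => xi i @^-1` [set x i] end.
transitivity (P [set w | forall i, (i < M.+2)%N -> E i w]).
  congr (P _); apply/seteqP; split => w /=.
    by move=> [[D0w Bw] xw] [|[|i]]//= iM; exact: xw.
  move=> Ew; split; first by split; [exact: (Ew 0%N)|exact: (Ew 1%N)].
  by move=> i iM; exact: (Ew i.+2).
rewrite (mutually_independent_nat P _ E _ indep); last first.
  move=> [|[|i]] _ /=; last 2 first.
  - exact: counts_sigma.
  - by exists [set x i] => //; rewrite setTI.
  by exists [set k0] => //; rewrite setTI.
rewrite !big_ord_recl /= counts_prob.
rewrite (_ : P _ = (4^-1)%:E); last exact: D0_unif.
rewrite -mulrA !EFinM -prodEFin; congr (_ * (_ * _))%E.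
by rewrite -[RHS]prodEFin; apply: eq_bigr => i _; exact: xi_turn.
Qed.

Let inc i w := dir (t i.+1) w - dir (t i) w.

Let walk i n k := pois i n * fourier_pmf ((1 - 2 * q) ^+ n) ((1 - q) ^+ n) k.
Let mixed i k :=
  fourier_pmf (expR (- (2 * (q * mass i)))) (expR (- (q * mass i))) k.

(** Once the event counts are prescribed, the increments of the direction are sums
over prescribed consecutive blocks of turns. *)
Lemma fixed_counts_prob k0 (n : nat -> nat) (k : nat -> 'Z_4) m :
  P [set w | (D0 w = k0 /\ forall i, (i < m)%N -> J i w = n i) /\
             forall i, (i < m)%N -> inc i w = k i] =
  (4^-1 * \prod_(i < m) walk i (n i) (k i))%:E.
Proof.
have := tail_independent_prob _ _ _ _ _ _ (tail_independent_walks P xi _ q _ _ n k m erefl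
  (tail_independent_start k0 n m)).
rewrite -mulrA -big_split /= => <-; congr (P _).
have incE w i : (forall i, (i < m)%N -> J i w = n i) -> (i < m)%N ->
    inc i w = \sum_(l < n i) xi (\sum_(h < i) n h + l)%N w.
  move=> /countsE Nn im.
  have Ni : N (t i) w = (\sum_(h < i) n h)%N.
    case: i im => [|i] im; last by rewrite Nn// ltnW.
    by rewrite big_ord0 t0; case: N_poisson => _ _ /(_ w)[].
  rewrite /inc /dir /direction Nn// Ni big_ord_recr /= big_split_ord /=.
  by rewrite opprD addrACA subrr add0r addrAC subrr add0r.
by apply/seteqP; split => w /= [[D0w Jw] kw]; split => // i im;
  rewrite -kw// incE.
Qed.

Lemma measurable_counts_increments k0 (n : nat -> nat) (k : nat -> 'Z_4) j m :
  measurable [set w | (D0 w = k0 /\ forall i, (i < j)%N -> J i w = n i) /\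
                      forall i, (i < m)%N -> inc i w = k i].
Proof.
apply: measurableI; first by have [] := tail_independent_start k0 n j.
apply: measurable_forall_lt => i _.
have minc : measurable_fun setT (inc i).
  by apply: (measurable_Z4_op (fun x y => x - y)); exact: measurable_direction.
have := minc measurableT [set k i]; rewrite setTI; exact.
Qed.

(** Only the first j event counts are prescribed.  Downward induction on j, with
l = m - j: dropping the prescription of the count over the j-th interval is a sum
over its values, which replaces one Poisson weight times an n-step probability by
their Poisson average. *)
Lemma partial_counts_prob k0 (k : nat -> 'Z_4) m l j (n : nat -> nat) :
  (j + l = m)%N ->
  P [set w | (D0 w = k0 /\ forall i, (i < j)%N -> J i w = n i) /\
             forall i, (i < m)%N -> inc i w = k i] =
  (4^-1 * \prod_(i < m) (if (i < j)%N then walk i (n i) (k i) else mixed i (k i)))%:E.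
Proof.
elim: l j n => [|l IHl] j n jlm.
  rewrite -jlm addn0 fixed_counts_prob; congr (_ * _)%:E.
  by apply: eq_bigr => i _; rewrite ltn_ord.
have jm : (j < m)%N by rewrite -jlm addnS ltnS leq_addr.
pose upd a i := if i == j then a else n i.
pose E a := [set w | (D0 w = k0 /\ forall i, (i < j.+1)%N -> J i w = upd a i) /\
             forall i, (i < m)%N -> inc i w = k i].
rewrite (_ : [set w | _] = \bigcup_a E a); last first.
  apply/seteqP; split => w /=.
    move=> [[D0w Jw] kw]; exists (J j w) => //; split => //; split => // i.
    rewrite ltnS /upd leq_eqVlt; have [->//|_ /=] := eqVneq i j; exact: Jw.
  move=> [a _ [[D0w Jw] kw]]; split => //; split => // i ij.
  by rewrite (Jw i (leqW ij)) /upd (ltn_eqF ij).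
rewrite measure_semi_bigcup; last 3 first.
- by move=> a; exact: measurable_counts_increments.
- move=> a b _ _ [w [[[_ Ja] _] [[_ Jb] _]]].
  by have := Ja j (leqnn _); rewrite Jb// /upd eqxx.
- by apply: bigcupT_measurable => a; exact: measurable_counts_increments.
pose rest := \prod_(i < m | i != Ordinal jm)
  (if (i < j)%N then walk i (n i) (k i) else mixed i (k i)).
rewrite (_ : \prod_(i < m) _ = mixed j (k j) * rest); last first.
  by rewrite (bigD1 (Ordinal jm)) //= ltnn.
rewrite mulrCA mulrC.
have := poisson_mix (4^-1 * rest) (mass j) (1 - 2 * q) (1 - q) (k j).
rewrite /mixed (_ : mass j * (1 - 2 * q - 1) = - (2 * (q * mass j))); last by ring.
rewrite (_ : mass j * (1 - q - 1) = - (q * mass j)); last by ring.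
move=> <-; apply: eq_eseriesr => a _.
apply: etrans (IHl j.+1 (upd a) _) _; first by rewrite addSnnS.
congr EFin.
rewrite -(mulrA 4^-1); congr (_ * _); rewrite (bigD1 (Ordinal jm)) //= ltnSn /upd eqxx mulrC.
congr (_ * _); apply: eq_bigr => i ij.
have {}ij : (i : nat) != j by [].
by rewrite ltnS leq_eqVlt (negbTE ij).
Qed.

(** The rate and q occur in this formula only through q * mass i, where mass i is
the integral of the rate over the i-th interval. *)
Lemma direction_prob (k : nat -> 'Z_4) m :
  P [set w | forall i, (i <= m)%N -> dir (t i) w = k i] =
  (4^-1 * \prod_(i < m) mixed i (k i.+1 - k i))%:E.
Proof.
have := partial_counts_prob (k 0%N) (fun i => k i.+1 - k i) m m 0 (fun=> 0%N) (add0n m).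
move=> <-; congr (P _).
have D0E w : dir (t 0%N) w = D0 w.
  rewrite /dir /direction t0; case: N_poisson => _ _ /(_ w)[-> _ _] _ _.
  by rewrite big_ord0 addr0.
apply/seteqP; split => w /=.
  move=> dk; split; first by split => //; rewrite -D0E dk.
  by move=> i im; rewrite /inc !dk// ltnW.
move=> [[D0w _] kw]; elim=> [|i IHi] im; first by rewrite D0E.
by rewrite -(subrK (dir (t i) w) (dir (t i.+1) w)) -/(inc i w) kw// IHi ?(ltnW im)// subrK.
Qed.

End increments.
End motion.
(** * From finite-dimensional laws to the law of the position *)

Section law_of_direction_paths.
Context {R : realType}.

(** Lists of constraints in any order, possibly repeated or contradictory, so that
intersection is concatenation. *)
Definition cylinder (zs : seq (R * 'Z_4)) : set (@direction_path R) :=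
  [set w | all (fun z => w z.1 == z.2) zs].

Definition cylinders : set (set (@direction_path R)) :=
  [set C | exists2 zs, all (fun z : R * 'Z_4 => 0 <= z.1) zs & C = cylinder zs].

Lemma setI_closed_cylinders : setI_closed cylinders.
Proof.
move=> _ _ [zs zs0 ->] [zs' zs'0 ->]; exists (zs ++ zs').
  by rewrite all_cat zs0.
by apply/seteqP; split => w; rewrite /cylinder /= all_cat => /andP.
Qed.

Lemma measurable_cylinder zs : all (fun z : R * 'Z_4 => 0 <= z.1) zs ->
  measurable (cylinder zs).
Proof.
elim: zs => [_|[t k] zs IHzs /= /andP[t0 zs0]].
  by rewrite (_ : cylinder _ = setT) //; apply/seteqP.
rewrite (_ : cylinder _ = (fun w : direction_path => w t) @^-1` [set k] `&` cylinder zs).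
  apply: measurableI; last exact: IHzs.
  by rewrite -[X in measurable X]setTI; exact: measurable_eval.
apply/seteqP; split => w; rewrite /cylinder /=; first by move=> /andP[/eqP].
by move=> [-> ->]; rewrite eqxx.
Qed.

Lemma measurable_direction_pathE :
  @measurable _ (@direction_path R) = <<s cylinders >>.
Proof.
apply/seteqP; split; last first.
  apply: smallest_sub; first exact: sigma_algebra_measurable.
  by move=> _ [zs zs0 ->]; exact: measurable_cylinder.
apply: smallest_sub; first exact: smallest_sigma_algebra.
move=> _ [t t0] [B _ <-].
rewrite setTI (_ : _ @^-1` B = \bigcup_(k in B) cylinder [:: (t, k)]).
  apply: (@fin_bigcup_measurable _ (g_sigma_algebraType cylinders)).
    exact: finite_finset.
  by move=> k _; apply: sub_sigma_algebra; exists [:: (t, k)] => //=; rewrite t0.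
apply/seteqP; split => w /=; first by exists (w t) => //; rewrite /cylinder /= eqxx.
by move=> [k Bk]; rewrite /cylinder /= andbT => /eqP ->.
Qed.

(** Sorting the constraints by time does not change the cylinder.  The constraint
at time 0 is put in front, and beyond the last constraint the times are continued
by the last one in order to get a nondecreasing sequence. *)
Lemma cylinder_sorted zs k0 : all (fun z : R * 'Z_4 => 0 <= z.1) zs ->
  exists (t : nat -> R) (k : nat -> 'Z_4) (m : nat),
    [/\ t 0%N = 0, (forall i, t i <= t i.+1) &
        forall w, (w 0 = k0 /\ cylinder zs w) <->
                  (forall i, (i <= m)%N -> w (t i) = k i)].
Proof.
move=> zs0; pose le1 := fun z z' : R * 'Z_4 => z.1 <= z'.1.
pose a := (0, k0) :: sort le1 zs.
have le1_tr : transitive le1 by move=> ? ? ?; exact: le_trans.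
have a_sorted : sorted le1 a.
  rewrite /= path_sortedE// all_sort zs0.
  by apply: sort_sorted => ? ?; exact: le_total.
exists (fun i => (nth (0, k0) a (minn i (size zs))).1).
exists (fun i => (nth (0, k0) a i).2), (size zs).
have sa : size a = (size zs).+1 by rewrite /= size_sort.
split => [|i|w].
- by rewrite min0n.
- apply: (sorted_leq_nth le1_tr _ (0, k0) a_sorted).
  + by move=> ?; exact: lexx.
  + by rewrite inE sa ltnS geq_minr.
  + by rewrite inE sa ltnS geq_minr.
  + by rewrite leq_min geq_minr (leq_trans (geq_minl _ _)).
have -> : (w 0 = k0 /\ cylinder zs w) <-> all (fun z => w z.1 == z.2) a.
  by rewrite /= all_sort; split => [[-> ->]|/andP[/eqP]//]; rewrite eqxx.
split => [/(all_nthP (0, k0)) aw i im|aw].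
  by rewrite (minn_idPl im); apply/eqP/aw; rewrite sa ltnS.
apply/(all_nthP (0, k0)) => i; rewrite sa ltnS => im.
by have := aw i im; rewrite (minn_idPl im) => ->.
Qed.

Context {d} {T : measurableType d} (P : probability T R).
Context {d'} {T' : measurableType d'} (P' : probability T' R).
Variables (f : R -> T -> 'Z_4) (f' : R -> T' -> 'Z_4).
Hypothesis mf : forall t, 0 <= t -> measurable_fun setT (f t).
Hypothesis mf' : forall t, 0 <= t -> measurable_fun setT (f' t).

Lemma measurable_direction_path {e} {S : measurableType e} (g : R -> S -> 'Z_4)
    (A : set (@direction_path R)) :
  (forall t, 0 <= t -> measurable_fun setT (g t)) -> measurable A ->
  measurable [set w | A (g ^~ w)].
Proof.
move=> mg mA.
have mG : measurable_fun setT ((fun w => g ^~ w) : S -> @direction_path R).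
  apply: (@measurability _ _ S (@direction_path R) _ _ (\bigcup_(t in [set t : R | 0 <= t])
    preimage_set_system setT (fun w : R -> 'Z_4 => w t) measurable)) => //.
  move=> _ [_ [t t0 [B _ <-]] <-].
  by rewrite !setTI; have := mg t t0 measurableT B; rewrite setTI; exact.
have := mG measurableT A mA; rewrite setTI; exact.
Qed.

(** Dynkin's lemma for the pi-system of cylinders; the finite-dimensional laws
start at time 0, so a cylinder is first split according to the direction at that
time. *)
Lemma direction_law_unique :
  (forall (t : nat -> R) (k : nat -> 'Z_4) m,
    t 0%N = 0 -> (forall i, t i <= t i.+1) ->
    P [set w | forall i, (i <= m)%N -> f (t i) w = k i] =
    P' [set w | forall i, (i <= m)%N -> f' (t i) w = k i]) ->
  forall A : set (@direction_path R), measurable A ->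
    P [set w | A (f ^~ w)] = P' [set w | A (f' ^~ w)].
Proof.
move=> fdd A mA.
pose same (B : set (@direction_path R)) :=
  P [set w | B (f ^~ w)] = P' [set w | B (f' ^~ w)].
rewrite measurable_direction_pathE in mA; move: A mA; rewrite -/(same _).
apply: (@dynkin_induction _ _ _ same measurable_direction_pathE
  setI_closed_cylinders) => [||A mA PA|A mA tA PA]; rewrite /same.
- by rewrite (_ : [set w | _] = setT) // (_ : [set w | _] = setT) // !probability_setT.
- move=> _ [zs zs0 ->].
  have split0 e (S : measurableType e) (Q : probability S R) (g : R -> S -> 'Z_4) :
      (forall t, 0 <= t -> measurable_fun setT (g t)) ->
      Q [set w | cylinder zs (g ^~ w)] =
      (\sum_l Q [set w | g 0%R w = l /\ cylinder zs (g ^~ w)])%E.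
    move=> mg; rewrite -measure_exists.
    + by congr (Q _); apply/seteqP; split => w /=; [exists (g 0 w)|case=> ? []].
    + move=> l; apply: measurableI; last first.
        by apply: measurable_direction_path => //; exact: measurable_cylinder.
      by have := mg 0 (lexx _) measurableT [set l]; rewrite setTI; exact.
    + by move=> l m w [<-] _ [].
  rewrite !split0//; apply: eq_bigr => l _.
  have [t [k [m [t0 t_nd cE]]]] := cylinder_sorted _ l zs0.
  have := fdd t k m t0 t_nd.
  rewrite (_ : [set w | _] = [set w | f 0 w = l /\ cylinder zs (f ^~ w)]).
    move=> ->; congr (P' _); apply/seteqP; split => w /=.
      by move/(cE (f' ^~ w)).
    by move/(cE (f' ^~ w)).
  by apply/seteqP; split => w /= /(cE (f ^~ w)).
- rewrite (_ : [set w | _] = ~` [set w | A (f ^~ w)]) //.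
  rewrite (_ : [set w | _] = ~` [set w | A (f' ^~ w)]) //.
  by rewrite !probability_setC ?PA//; exact: measurable_direction_path.
- rewrite (_ : [set w | _] = \bigcup_n [set w | A n (f ^~ w)]) //.
  rewrite (_ : [set w | _] = \bigcup_n [set w | A n (f' ^~ w)]) //.
  have tf (S : Type) (g : S -> R -> 'Z_4) : trivIset setT (fun n => [set w | A n (g w)]).
    by move=> i j _ _ [w [Ai Aj]]; apply: tA => //; exists (g w).
  rewrite !measure_semi_bigcup//; first by apply: eq_eseriesr => n _; exact: PA.
  all: by [move=> n; exact: measurable_direction_path|
           apply: bigcupT_measurable => n; exact: measurable_direction_path|exact: tf].
Qed.

(** The sets A for which both position events are the preimages, under the two
direction processes, of one measurable set of direction paths form a
sigma-algebra containing the generators of path_sigma. *)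
Lemma equal_in_distribution_displacement (phi psi : 'Z_4 -> R)
    (X Y : R -> T -> R) (X' Y' : R -> T' -> R) :
  (forall A : set (@direction_path R), measurable A ->
    P [set w | A (f ^~ w)] = P' [set w | A (f' ^~ w)]) ->
  (forall t w, 0 <= t -> X t w = displacement phi t (f ^~ w) /\
                         Y t w = displacement psi t (f ^~ w)) ->
  (forall t w, 0 <= t -> X' t w = displacement phi t (f' ^~ w) /\
                         Y' t w = displacement psi t (f' ^~ w)) ->
  equal_in_distribution P X Y P' X' Y'.
Proof.
move=> lawE XE XE'.
pose Phi (w : @direction_path R) t := (displacement phi t w, displacement psi t w).
pose good := [set A : set (R -> R * R) |
  [/\ measurable (Phi @^-1` A),
      (fun w t => (X t w, Y t w)) @^-1` A = (fun w => f ^~ w) @^-1` (Phi @^-1` A) &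
      (fun w t => (X' t w, Y' t w)) @^-1` A = (fun w => f' ^~ w) @^-1` (Phi @^-1` A)]].
suff good_sigma : path_sigma `<=` good.
  move=> A /good_sigma[mA AE AE'].
  transitivity (P ((fun w => f ^~ w) @^-1` (Phi @^-1` A))); first by rewrite -AE.
  transitivity (P' ((fun w => f' ^~ w) @^-1` (Phi @^-1` A))); last by rewrite -AE'.
  exact: lawE.
apply: smallest_sub.
  split.
  - by split; rewrite ?preimage_set0.
  - move=> A [mA AE AE']; rewrite setTD; split.
    + by rewrite preimage_setC; exact: measurableC.
    + exact: (congr1 setC AE).
    + exact: (congr1 setC AE').
  - move=> A goodA; split.
    + rewrite preimage_bigcup.
      by apply: bigcupT_measurable => n; have [] := goodA n.
    + apply: (@eq_bigcupr _ _ setT) => n _.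
      by have [_ AE _] := goodA n.
    + apply: (@eq_bigcupr _ _ setT) => n _.
      by have [_ _ AE] := goodA n.
move=> _ [t t0] [B mB <-]; rewrite setTI; split.
- have mPhi : measurable_fun setT (fun w => Phi w t).
    by apply: measurable_fun_pair; exact: measurable_displacement.
  by have := mPhi measurableT B mB; rewrite setTI; exact.
- by apply/funext => w /=; rewrite /preimage /Phi /=; have [-> ->] := XE t w t0.
- by apply/funext => w /=; rewrite /preimage /Phi /=; have [-> ->] := XE' t w t0.
Qed.

End law_of_direction_paths.

Lemma standard_turnE {R : realType} : standard_turn = bernoulli_turn 1 :> ('Z_4 -> R).
Proof.
apply/funext => k; rewrite /standard_turn /bernoulli_turn subrr mul1r.
by case: (eqVneq k 0) => [->|].
Qed.

Theorem mainTheorem5 (R : realType) (q c : R) (lambda : R -> R)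
  (hq0 : 0 < q) (hq1 : q <= 1) (hc : 0 < c)
  (hlambda0 : forall t : R, 0 < t -> 0 <= lambda t)
  (hlambda2 : C2_pos lambda)
  (d : measure_display) (T : measurableType d) (P : probability T R)
  (X Y : R -> T -> R)
  (hXY : is_q_standard_motion P q c lambda X Y)
  (d' : measure_display) (T' : measurableType d') (P' : probability T' R)
  (X' Y' : R -> T' -> R)
  (hXY' : is_standard_motion P' c (fun t => q * lambda t) X' Y') :
  equal_in_distribution P X Y P' X' Y'.
Proof.
case: hXY => D0 [N [xi [D0u Np xit ind XE]]].
move: hXY'; rewrite /is_standard_motion standard_turnE.
case=> D0' [N' [xi' [D0u' Np' xit' ind' XE']]].
pose phi (k : 'Z_4) := c * cos ((k : nat)%:R * pi / 2).
pose psi (k : 'Z_4) := c * sin ((k : nat)%:R * pi / 2).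
apply: (equal_in_distribution_displacement P P' (direction D0 N xi)
  (direction D0' N' xi') phi psi); first last.
- move=> t w t0; have [-> ->] := XE' t w t0.
  by rewrite !displacement_right_cont // => s s0; exact: direction_right_cont Np' _ _ s0.
- move=> t w t0; have [-> ->] := XE t w t0.
  by rewrite !displacement_right_cont // => s s0; exact: direction_right_cont Np _ _ s0.
apply: direction_law_unique.
- by move=> t t0; exact: (measurable_direction P lambda).
- by move=> t t0; exact: (measurable_direction P' (fun t => q * lambda t)).
move=> t k m t0 t_nd.
rewrite (direction_prob P q lambda D0 N xi D0u Np xit ind t t0 t_nd).
rewrite (direction_prob P' 1 _ D0' N' xi' D0u' Np' xit' ind' t t0 t_nd).
congr (_ * _)%:E; apply: eq_bigr => i _.
(* Remaining: q * (integral of lambda) = integral of (q * lambda), on an interval. *)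
rewrite !mul1r RintegralZl//.
case: Np => lambda_int _ _ _ _.
have [t1|t1] := ltP 0 (t i.+1); last first.
  rewrite set_itv_ge; first exact: integrable_set0.
  rewrite bnd_simp -leNgt (le_trans t1)//.
  by elim: (i : nat) => [|j /le_trans]; rewrite ?t0//; apply.
apply: integrableS (lambda_int _ t1) => //.
apply: subset_itvr; rewrite bnd_simp.
by elim: (i : nat) => [|j /le_trans]; rewrite ?t0//; apply.
Qed.
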